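(* For every $\varepsilon>0$ there exists $t_0$ such that for every integer $t\geq t_0$ there is a graph $G$ with no $K_t$-minor whose $(\frac32-\varepsilon)t$-colourings are not all Kempe equivalent.
   Context: All graphs are finite and simple, and all colourings are proper: a $k$-colouring of $G$ assigns to each vertex one of $k$ colours so that adjacent vertices receive different colours. Given a $k$-colouring $\alpha$ of $G$ and two colours $c_1,c_2$, a Kempe chain is a connected component of the subgraph of $G$ induced by the vertices coloured $c_1$ or $c_2$ (a vertex coloured $c_1$ with no neighbour coloured $c_2$ forms a Kempe chain by itself). A Kempe change swaps the two colours on one Kempe chain, yielding another $k$-colouring. Two $k$-colourings are Kempe equivalent if one can be obtained from the other by a finite sequence of Kempe changes. A graph $G$ has a $K_p$-minor if there are $p$ non-empty, pairwise disjoint vertex sets $B_1,\dots,B_p\subseteq V(G)$, each inducing a connected subgraph, such that for all $i\neq j$ there is an edge between a vertex of $B_i$ and a vertex of $B_j$. *)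

(* Defs.v *)
From HB Require Import structures.
From mathcomp Require Import all_boot all_order all_algebra all_fingroup.
From mathcomp Require Import reals.

Set Implicit Arguments.
Unset Strict Implicit.
Unset Printing Implicit Defensive.

Record sgraph := SGraph {
  vertex :> finType;
  adj : rel vertex;
  adj_sym : symmetric adj;
  adj_irrefl : irreflexive adj
}.

Section Defs.
Variable G : sgraph.

Definition induced_adj (A : {set G}) : rel G :=
  [rel x y | [&& x \in A, y \in A & adj x y]].

(* For x \in A, this is a subset of A: the vertex set of the connected
   component of x in G[A]. *)
Definition component (A : {set G}) (x : G) : {set G} :=
  [set y | connect (induced_adj A) x y].

Definition induces_connected (A : {set G}) : Prop :=
  A != set0 /\ {in A &, forall x y, connect (induced_adj A) x y}.

Definition has_complete_minor (p : nat) : Prop :=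
  exists B : 'I_p -> {set G},
    [/\ forall i, induces_connected (B i),
        forall i j, i != j -> [disjoint B i & B j]
      & forall i j, i != j ->
          exists x y, [/\ x \in B i, y \in B j & adj x y]].

Variable k : nat.
Implicit Types a b : {ffun G -> 'I_k}.

Definition proper_colouring a : bool :=
  [forall x, forall y, adj x y ==> (a x != a y)].

Definition bicoloured a (c1 c2 : 'I_k) : {set G} :=
  [set x | (a x == c1) || (a x == c2)].

Definition kempe_chain a (c1 c2 : 'I_k) (K : {set G}) : bool :=
  [exists x in bicoloured a c1 c2, K == component (bicoloured a c1 c2) x].

Definition swap_colours a (c1 c2 : 'I_k) (K : {set G}) : {ffun G -> 'I_k} :=
  [ffun x => if x \in K then tperm c1 c2 (a x) else a x].

Definition kempe_change a b : bool :=
  [exists c1 : 'I_k, exists c2 : 'I_k, exists K : {set G},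
     [&& c1 != c2, kempe_chain a c1 c2 K & b == swap_colours a c1 c2 K]].

(* Kempe changes preserve properness, so every colouring reached from a proper
   one is proper. *)
Definition kempe_equivalent a b : bool := connect kempe_change a b.

End Defs.

Definition all_colourings_kempe_equivalent (G : sgraph) (k : nat) : Prop :=
  forall a b : {ffun G -> 'I_k},
    proper_colouring a -> proper_colouring b -> kempe_equivalent a b.

(* Main.v *)
Require Import Defs.
From HB Require Import structures.
From mathcomp Require Import all_boot all_order all_algebra all_fingroup.
From mathcomp Require Import reals.
From mathcomp Require Import zify lra.

Set Implicit Arguments.
Unset Strict Implicit.
Unset Printing Implicit Defensive.

(** With [n] colours, the graph has [n] independent pairs of vertices, and
    between any two pairs three of the four possible edges, the missing one
    being chosen at random.  Colouring each pair with its own colour is frozen: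
    two colour classes induce a path on four vertices, so every Kempe change
    just permutes the colours.  Prescribing the missing edges between three of
    the pairs so that they induce a triangular prism provides a colouring with
    a different partition into classes.

    A [K_t]-minor with [3t] well above [2n] has linearly many branch sets of
    size at most 2, and a constant proportion of them, say [2m], use distinct
    pairs.  Two such sets are non-adjacent with probability at least [1/256],
    independently, so a union bound over [(2n)^(4m)] families against the
    probability [(255/256)^(m^2)] leaves a graph with no such minor. *)

Section FiniteSets.
Variables (U I : finType).
Implicit Types (B : I -> {set U}) (P Q S : {set I}).

Lemma leq_card_bigcup B P : #|\bigcup_(i in P) B i| <= \sum_(i in P) #|B i|.
Proof.
apply: (big_ind2 (fun (A : {set U}) a => #|A| <= a)) => [|A a A' a' leA leA'|//].
  by rewrite cards0.
exact: leq_trans (leq_card_setU _ _) (leq_add leA leA').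
Qed.

Lemma card_bigcup_bounded B P s :
  {in P, forall i, #|B i| <= s} -> #|\bigcup_(i in P) B i| <= s * #|P|.
Proof.
move=> leB; apply: leq_trans (leq_card_bigcup _ _) _.
by rewrite mulnC -sum_nat_const; apply: leq_sum.
Qed.

Lemma card_preimset_bounded (f : U -> I) P d :
  (forall i, #|f @^-1: [set i]| <= d) -> #|f @^-1: P| <= d * #|P|.
Proof.
move=> led; suff -> : f @^-1: P = \bigcup_(i in P) f @^-1: [set i].
  exact: card_bigcup_bounded.
apply/setP => u; rewrite inE; apply/idP/bigcupP => [Pu|[i Pi]].
  by exists (f u); rewrite ?inE.
by rewrite !inE => /eqP ->.
Qed.

Lemma exists_injection_into (Q : {set U}) :
  #|I| <= #|Q| -> exists2 e : I -> U, injective e & forall i, e i \in Q.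
Proof.
move=> leIQ; exists (fun i => enum_val (widen_ord leIQ (enum_rank i))) => [i j|i].
  by move=> /enum_val_inj /(congr1 val) /= /ord_inj /enum_rank_inj.
exact: enum_valP.
Qed.

Lemma card_sets_of_size_1_or_2 : #|[set A : {set U} | 0 < #|A| <= 2]| <= #|U| ^ 2.
Proof.
rewrite -mulnn -card_prod -cardsT.
apply: leq_trans (leq_imset_card (fun p : U * U => [set p.1; p.2]) _).
apply/subset_leq_card/subsetP => A; rewrite inE => /andP[A_gt0 A_le2].
have [/eqP/cards1P[u ->]|A_neq1] := eqVneq #|A| 1.
  by apply/imsetP; exists (u, u); rewrite ?inE // setUid.
have /cards2P[u [v [_ ->]]] : #|A| == 2 by lia.
by apply/imsetP; exists (u, v).
Qed.

End FiniteSets.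

Lemma union_bound (W H : finType) (P : {set W}) (E : W -> {set H}) x y :
    {in P, forall w, #|E w| * x <= y * #|H|} -> 0 < #|H| -> #|P| * y < x ->
  exists h, {in P, forall w, h \notin E w}.
Proof.
move=> leE H_gt0 ltPx; pose bad := \bigcup_(w in P) E w.
have le_bad : #|bad| * x <= #|P| * y * #|H|.
  apply: leq_trans (leq_mul (leq_card_bigcup _ _) (leqnn x)) _.
  by rewrite big_distrl -mulnA -sum_nat_const; apply: leq_sum.
have [h hbad] : exists h, h \notin bad.
  apply/existsP; rewrite -negb_forall; apply: contraTN ltPx => /forallP allbad.
  have badH : #|bad| = #|H| by apply: eq_card => h; rewrite allbad inE.
  by move: le_bad; rewrite badH mulnC leq_pmul2r // -leqNgt.
exists h => w Pw; apply: contra hbad => Ewh.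
by apply/bigcupP; exists w.
Qed.

Section Deviation.
Variables (T R : finType) (g : T -> R).
Implicit Types (h : {ffun T -> R}) (D : {set T}).

Definition deviates h D := [exists d in D, h d != g d].

Definition overwrite D h : {ffun T -> R} :=
  [ffun d => if d \in D then g d else h d].

Lemma overwrite_not_deviates D h : ~~ deviates (overwrite D h) D.
Proof. by apply/exists_inPn => d Dd; rewrite negbK ffunE Dd. Qed.

Lemma deviates_overwrite D D' h :
  [disjoint D & D'] -> deviates h D' -> deviates (overwrite D h) D'.
Proof.
move=> disjDD' /exists_inP[d D'd hd]; apply/exists_inP; exists d => //.
by rewrite ffunE (disjointFl disjDD' D'd).
Qed.

(* [h] is determined by its restriction to [D] together with [overwrite D h],
   which lies in [A] and does not deviate on [D]. *)
Lemma card_deviates (A : {set {ffun T -> R}}) D q :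
    #|R| ^ #|D| <= q.+1 -> {in A, forall h, overwrite D h \in A} ->
  #|[set h in A | deviates h D]| * q.+1 <= q * #|A|.
Proof.
move=> leDq closedA; pose M := [set h in A | ~~ deviates h D].
have cardA : #|A| = #|[set h in A | deviates h D]| + #|M|.
  rewrite -(cardsID [set h | deviates h D] A); congr (_ + _); apply: eq_card => h.
    by rewrite !inE.
  by rewrite !inE andbC.
have leA : #|A| <= #|M| * #|R| ^ #|D|.
  pose restrict h : {ffun {d | d \in D} -> R} := [ffun d => h (val d)].
  have -> : #|R| ^ #|D| = #|[set: {ffun {d | d \in D} -> R}]|.
    by rewrite cardsT card_ffun card_sig.
  rewrite -cardsX.
  rewrite -(@card_in_imset _ _ (fun h => (overwrite D h, restrict h)) A).
    apply/subset_leq_card/subsetP => _ /imsetP[h Ah ->].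
    by rewrite !inE closedA //= overwrite_not_deviates.
  move=> h1 h2 _ _ [eqO eqR]; apply/ffunP => d; case Dd: (d \in D).
    by move/ffunP/(_ (exist _ d Dd)): eqR; rewrite !ffunE.
  by move/ffunP/(_ d): eqO; rewrite !ffunE Dd.
have : #|A| <= #|M| * q.+1 by apply: leq_trans leA _; rewrite leq_mul2l leDq orbT.
by rewrite cardA; lia.
Qed.

Variables (I : finType) (D : I -> {set T}) (q : nat).
Hypothesis leDq : forall i, #|R| ^ #|D i| <= q.+1.
Hypothesis disjD : forall i j, i != j -> [disjoint D i & D j].

Lemma card_all_deviate (r : seq I) : uniq r ->
  #|[set h | all (fun i => deviates h (D i)) r]| * q.+1 ^ size r
    <= q ^ size r * #|{ffun T -> R}|.
Proof.
elim: r => [_|i r IHr /= /andP[inotr uniqr]]; first by rewrite muln1 mul1n max_card.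
set A := [set h | all (fun j => deviates h (D j)) r] in IHr *.
have closedA : {in A, forall h, overwrite (D i) h \in A}.
  move=> h; rewrite !inE => /allP dev_h; apply/allP => j rj.
  apply: deviates_overwrite (dev_h j rj); apply: disjD.
  by apply: contraNneq inotr => ->.
have -> : [set h | deviates h (D i) && all (fun j => deviates h (D j)) r]
        = [set h in A | deviates h (D i)].
  by apply/setP => h; rewrite !inE andbC.
have dev_i := card_deviates (leDq i) closedA; rewrite !expnS mulnA.
by apply: leq_trans (leq_mul dev_i (leqnn _)) _; rewrite -!mulnA leq_mul2l IHr ?orbT.
Qed.

Lemma card_forall_deviates :
  #|[set h | [forall i, deviates h (D i)]]| * q.+1 ^ #|I|
    <= q ^ #|I| * #|{ffun T -> R}|.
Proof.
rewrite cardT; apply: leq_trans (card_all_deviate (enum_uniq I)).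
rewrite leq_mul2r subset_leq_card ?orbT //; apply/subsetP => h.
by rewrite !inE => /forallP dev_h; apply/allP.
Qed.

End Deviation.

Section DisjointFamily.
Variables (U I : finType) (B : I -> {set U}).
Hypothesis disjB : forall i j, i != j -> [disjoint B i & B j].

Lemma sum_card_setI (X : {set U}) : \sum_i #|B i :&: X| <= #|X|.
Proof.
have disjBX i j : i != j -> [disjoint B i :&: X & B j :&: X].
  by move=> /disjB; apply: disjointW; apply: subsetIl.
under eq_bigr do rewrite -sum1_card; rewrite -partition_disjoint_bigcup // sum1_card.
by apply/subset_leq_card/bigcupsP => i _; apply: subsetIr.
Qed.

Lemma card_meeting_members (X : {set U}) : #|[set i | B i :&: X != set0]| <= #|X|.
Proof.
apply: leq_trans (sum_card_setI X); rewrite -sum1_card big_mkcond /=.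
by apply: leq_sum => i _; rewrite inE -card_gt0; case: ifP.
Qed.

Lemma card_small_members s : (forall i, B i != set0) ->
  s.+1 * #|I| <= #|U| + s * #|[set i | #|B i| <= s]|.
Proof.
move=> nzB; have sumB : \sum_i #|B i| <= #|U|.
  by rewrite -cardsT; under eq_bigr do rewrite -[B _]setIT; apply: sum_card_setI.
rewrite mulnC -sum_nat_const -sum1_card big_distrr [in leqRHS]big_mkcond /=.
apply: leq_trans (leq_add sumB (leqnn _)); rewrite -big_split /=.
apply: leq_sum => i _; rewrite inE.
by case: (leqP #|B i| s) (nzB i); rewrite -card_gt0; lia.
Qed.

Variables (J : finType) (f : U -> J) (F : {set J}) (Q : {set I}) (s d : nat).
Hypothesis card_fibre : forall j, #|f @^-1: [set j]| <= d.
Hypothesis injB : {in Q, forall i, {in B i &, injective f}}.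
Hypothesis cardB : {in Q, forall i, 0 < #|B i| <= s}.

Definition injective_avoiding (S : {set I}) :=
  [&& S \subset Q, [forall u in \bigcup_(i in S) B i, f u \notin F]
    & dinjectiveb f (\bigcup_(i in S) B i)].

Lemma injective_avoiding_setU1 (S : {set I}) i :
    injective_avoiding S -> i \in Q ->
    {in B i, forall u, f u \notin F :|: f @: \bigcup_(j in S) B j} ->
  injective_avoiding (i |: S).
Proof.
move=> /and3P[SQ /forall_inP avoidS /dinjectiveP injS] Qi new_i.
have new u v : u \in B i -> v \in \bigcup_(j in S) B j -> f u != f v.
  move=> /new_i; rewrite inE negb_or => /andP[_] + Sv.
  by apply: contraNneq => ->; apply: imset_f.
rewrite /injective_avoiding subUset sub1set Qi SQ bigcup_setU big_set1 /=.
apply/andP; split.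
  apply/forall_inP => u /setUP[/new_i|/avoidS //].
  by rewrite inE negb_or => /andP[].
apply/dinjectiveP => u v /setUP[uB|uS] /setUP[vB|vS] /eqP fuv.
- by apply: (injB Qi) => //; apply/eqP.
- by rewrite (negbTE (new _ _ uB vS)) in fuv.
- by rewrite eq_sym (negbTE (new _ _ vB uS)) in fuv.
- by apply: injS => //; apply/eqP.
Qed.

Lemma exists_injective_subfamily : exists S : {set I},
  [/\ S \subset Q, {in \bigcup_(i in S) B i, forall u, f u \notin F},
      {in \bigcup_(i in S) B i &, injective f}
    & #|Q| <= d * (#|F| + s * #|S|)].
Proof.
have inj0 : injective_avoiding set0.
  rewrite /injective_avoiding sub0set big_set0 /=; apply/andP; split.
    by apply/forall_inP => u; rewrite inE.
  by apply/dinjectiveP => u v; rewrite inE.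
have [S /maxsetP[injS maxS] _] := maxset_exists inj0.
have /and3P[SQ /forall_inP avoidS /dinjectiveP injfS] := injS.
exists S; split=> //; pose X := F :|: f @: \bigcup_(i in S) B i.
have cardX : #|X| <= #|F| + s * #|S|.
  apply: leq_trans (leq_card_setU _ _) _; rewrite leq_add2l.
  apply: leq_trans (leq_imset_card _ _) (card_bigcup_bounded _) => i Si.
  by have /andP[] := cardB (subsetP SQ i Si).
apply: leq_trans (leq_mul (leqnn d) cardX).
apply: leq_trans (card_preimset_bounded _ card_fibre).
apply: leq_trans (card_meeting_members _); apply/subset_leq_card/subsetP => i Qi.
rewrite inE; apply/negP => /eqP BX0.
have new_i : {in B i, forall u, f u \notin X}.
  by move=> u Bu; move/setP/(_ u): BX0; rewrite !inE Bu /= => ->.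
have [+ _] := andP (cardB Qi); rewrite card_gt0 => /set0Pn[u Bu].
have iS : i \in S.
  have injSi := injective_avoiding_setU1 injS Qi new_i.
  by rewrite -(maxS _ injSi (subsetUr _ _)) setU11.
have /negP[] := new_i u Bu; rewrite inE imset_f ?orbT //.
by apply/bigcupP; exists i.
Qed.

End DisjointFamily.

Definition moved_points (T : finType) (s : {perm T}) := [set x | s x != x].

Definition two_cycle_free (T : finType) (s : {perm T}) :=
  forall x, s x != x -> s (s x) != x.

Lemma exists_three_cycle (T : finType) : 2 < #|T| ->
  exists s : {perm T},
    [/\ two_cycle_free s, exists x, s x != x & #|moved_points s| <= 3].
Proof.
move=> /card_gt2P[a [b [c [_ [nab nbc nca]]]]].
pose s := (tperm a b * tperm b c)%g.
have sa : s a = c by rewrite permM tpermL tpermL.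
have sb : s b = a by rewrite permM tpermR tpermD 1?eq_sym // eq_sym.
have sc : s c = b by rewrite permM [tperm a b c]tpermD ?tpermR // eq_sym.
have moved x : s x != x -> x \in [set a; b; c].
  rewrite !inE; apply: contraR; rewrite !negb_or => /andP[/andP[nxa nxb] nxc].
  by rewrite permM !tpermD // eq_sym.
exists s; split; [|by exists a; rewrite sa|].
  move=> x /moved; rewrite !inE => /orP[/orP[]|] /eqP ->.
  - by rewrite sa sc eq_sym.
  - by rewrite sb sa eq_sym.
  - by rewrite sc sb eq_sym.
apply: (@leq_trans #|[set a; b; c]|).
  by apply/subset_leq_card/subsetP => x; rewrite inE => /moved.
by rewrite -setUA cardsU1 cards2; lia.
Qed.

Section ConnectedSets.
Variable G : sgraph.
Implicit Types (A : {set G}) (x y : G).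

Lemma component_eq A x : x \in A ->
  {in A &, forall y z, connect (induced_adj A) y z} -> component A x = A.
Proof.
move=> Ax connA; apply/setP => y; rewrite inE.
apply/idP/idP => [|Ay]; last exact: connA.
move=> /connectP[p]; elim: p x Ax => [|z p IHp] x Ax /=; first by move=> _ ->.
by move=> /andP[/and3P[_ Az _]] /(IHp z Az).
Qed.

Lemma connected_card2_adj A : induces_connected A -> #|A| <= 2 ->
  {in A &, forall x y, x != y -> adj x y}.
Proof.
move=> [_ connA] A_le2 x y Ax Ay nxy.
have AE : A = [set x; y].
  apply/eqP; rewrite eq_sym eqEcard cards2 nxy A_le2 andbT.
  by apply/subsetP => z /set2P[] ->.
have /connectP[[|z p] /= path_p] := connA x y Ax Ay.
  by move=> eyx; rewrite eyx eqxx in nxy.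
move: path_p => /andP[/and3P[_ Az xz] _] _; move: Az xz; rewrite AE.
by move=> /set2P[] -> //; rewrite adj_irrefl.
Qed.

End ConnectedSets.

Section FrozenColourings.
Variables (G : sgraph) (k : nat).
Implicit Types (a b : {ffun G -> 'I_k}) (s : {perm 'I_k}).

Definition frozen a := forall c1 c2, c1 != c2 ->
  let A := bicoloured a c1 c2 in
  {in A &, forall x y, connect (induced_adj A) x y}.

Definition permute_colours s a : {ffun G -> 'I_k} := [ffun x => s (a x)].

Lemma bicoloured_permute s a c1 c2 :
  bicoloured (permute_colours s a) c1 c2 = bicoloured a (s^-1 c1)%g (s^-1 c2)%g.
Proof. by apply/setP => x; rewrite !inE ffunE !(canF_eq (permK s)). Qed.

Lemma frozen_permute s a : frozen a -> frozen (permute_colours s a).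
Proof.
move=> fr_a c1 c2 nc; rewrite bicoloured_permute; apply: fr_a.
by rewrite (inj_eq perm_inj).
Qed.

Lemma swap_bicoloured a c1 c2 :
  swap_colours a c1 c2 (bicoloured a c1 c2) = permute_colours (tperm c1 c2) a.
Proof.
apply/ffunP => x; rewrite !ffunE inE; case: ifP => // /norP[n1 n2].
by rewrite tpermD // eq_sym.
Qed.

Lemma frozen_kempe_change a b :
  frozen a -> kempe_change a b -> exists s, b = permute_colours s a.
Proof.
move=> fr_a /existsP[c1 /existsP[c2 /existsP[K /and3P[nc]]]] /exists_inP[x xA /eqP ->].
rewrite (component_eq xA (fr_a _ _ nc)) swap_bicoloured => /eqP ->.
by exists (tperm c1 c2).
Qed.

Lemma frozen_kempe_equivalent a b :
  frozen a -> kempe_equivalent a b -> exists s, b = permute_colours s a.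
Proof.
move=> + /connectP[p]; elim: p a => [|c p IHp] a fr_a /=.
  by move=> _ ->; exists 1%g; apply/ffunP => x; rewrite ffunE perm1.
move=> /andP[/(frozen_kempe_change fr_a)[s ->] path_p] last_p.
have [s' ->] := IHp _ (frozen_permute fr_a) path_p last_p.
by exists (s * s')%g; apply/ffunP => x; rewrite !ffunE permM.
Qed.

Lemma frozen_not_all_kempe_equivalent a b x y :
    proper_colouring a -> frozen a -> proper_colouring b ->
    a x = a y -> b x != b y ->
  ~ all_colourings_kempe_equivalent G k.
Proof.
move=> proper_a fr_a proper_b axy nbxy.
move=> /(_ a b proper_a proper_b) /(frozen_kempe_equivalent fr_a)[s bE].
by rewrite bE !ffunE axy eqxx in nbxy.
Qed.

End FrozenColourings.

Section GapGraph.
Variable I : finType.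
Local Notation V := (I * bool)%type.
Implicit Types (h : {ffun I * I -> bool}) (u v : V) (s : {perm I}).

(* The only non-edge between the pairs [i] and [j] joins [(i, h (i, j))] to
   [(j, h (j, i))]. *)
Definition gap h u v := (u.2 == h (u.1, v.1)) && (v.2 == h (v.1, u.1)).

Definition gap_adj h : rel V := fun u v => (u.1 != v.1) && ~~ gap h u v.

Lemma gap_sym h : symmetric (gap h).
Proof. by move=> u v; rewrite /gap andbC. Qed.

Lemma gap_adj_sym h : symmetric (gap_adj h).
Proof. by move=> u v; rewrite /gap_adj gap_sym eq_sym. Qed.

Lemma gap_adj_irrefl h : irreflexive (gap_adj h).
Proof. by move=> u; rewrite /gap_adj eqxx. Qed.

Definition gap_graph h := SGraph (gap_adj_sym h) (gap_adj_irrefl h).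

Lemma connected_card2_injective h (A : {set gap_graph h}) :
  induces_connected A -> #|A| <= 2 -> {in A &, injective fst}.
Proof.
move=> connA A_le2 u v Au Av uv; apply: contraTeq isT => nuv.
by have /andP[] := connected_card2_adj connA A_le2 Au Av nuv; rewrite uv eqxx.
Qed.

(* Puts the gap between the pairs [i] and [s i] at [(i, true)] and [(s i, false)],
   which is consistent as long as [s] has no 2-cycle. *)
Definition plant s h : {ffun I * I -> bool} :=
  [ffun d => if s d.1 == d.2 then true else if s d.2 == d.1 then false else h d].

Lemma gap_plant s h i : s (s i) != i -> gap (plant s h) (i, true) (s i, false).
Proof. by move=> nssi; rewrite /gap !ffunE /= !eqxx (negbTE nssi). Qed.

Lemma gap_plant_fixed s h u v : u.1 != v.1 -> s u.1 = u.1 -> s v.1 = v.1 ->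
  gap (plant s h) u v = gap h u v.
Proof.
by move=> nuv su sv; rewrite /gap !ffunE /= su sv [v.1 == u.1]eq_sym (negbTE nuv).
Qed.

End GapGraph.

Section Colourings.
Variable n : nat.
Implicit Types (h : {ffun 'I_n * 'I_n -> bool}) (s : {perm 'I_n}).

Definition pair_colouring h : {ffun gap_graph h -> 'I_n} := [ffun u => u.1].

Lemma pair_colouring_proper h : proper_colouring (pair_colouring h).
Proof.
apply/forallP => u; apply/forallP => v; apply/implyP => /andP[].
by rewrite !ffunE.
Qed.

Lemma pair_colouring_frozen h : frozen (pair_colouring h).
Proof.
move=> i j nij A.
have AE (u : gap_graph h) : (u \in A) = (u.1 == i) || (u.1 == j).
  by rewrite inE ffunE.
have symA : connect_sym (induced_adj A).
  by apply: sym_connect_sym => u v; rewrite /induced_adj /= gap_adj_sym andbCA.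
(* Both vertices of the pair [j] are adjacent to [r], and both vertices of the
   pair [i] to the vertex of [j] that is not in the gap. *)
pose r : gap_graph h := (i, ~~ h (i, j)).
have conn_rj y : connect (induced_adj A) r (j, y).
  apply: connect1; rewrite /induced_adj /= !AE /= !eqxx orbT /= /gap_adj /gap nij /=.
  by case: (h (i, j)).
have conn_ri y : connect (induced_adj A) r (i, y).
  apply: connect_trans (conn_rj (~~ h (j, i))) _; apply: connect1.
  rewrite /induced_adj /= !AE /= !eqxx orbT /= /gap_adj /gap eq_sym nij /=.
  by case: (h (j, i)).
have conn_r u : u \in A -> connect (induced_adj A) r u.
  by rewrite AE; case: u => l y /= /orP[]/eqP ->.
by move=> u v /conn_r + /conn_r; rewrite symA; apply: connect_trans.
Qed.

Definition twisted_colouring s h : {ffun gap_graph (plant s h) -> 'I_n} :=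
  [ffun u => if u.2 then s u.1 else u.1].

Lemma twisted_colouring_proper s h :
  two_cycle_free s -> proper_colouring (twisted_colouring s h).
Proof.
move=> free_s; apply/forallP => -[i x]; apply/forallP => -[j y].
apply/implyP => /andP[/= nij]; apply: contraNneq; rewrite !ffunE.
have gap_s l : s l != l -> gap (plant s h) (l, true) (s l, false).
  by move=> nsl; apply: gap_plant (free_s l nsl).
case: x y => [] [] /= eij.
- by rewrite (perm_inj eij) eqxx in nij.
- by rewrite -eij gap_s // eij eq_sym.
- by rewrite eij gap_sym gap_s // -eij.
- by rewrite eij eqxx in nij.
Qed.

Lemma planted_not_all_kempe_equivalent s h i :
  two_cycle_free s -> s i != i ->
  ~ all_colourings_kempe_equivalent (gap_graph (plant s h)) n.
Proof.
move=> free_s nsi; pose x : gap_graph (plant s h) := (i, true).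
apply: (@frozen_not_all_kempe_equivalent _ _ _ (twisted_colouring s h) x (i, false)).
- exact: pair_colouring_proper.
- exact: pair_colouring_frozen.
- exact: twisted_colouring_proper.
- by rewrite !ffunE.
- by rewrite !ffunE.
Qed.

End Colourings.

Section ScatteredFamilies.
Variables (I : finType) (m : nat).
Local Notation V := (I * bool)%type.
Implicit Types (h : {ffun I * I -> bool}) (w : {ffun bool * 'I_m -> {set V}}).

Definition scattered w :=
  [&& [forall z, 0 < #|w z| <= 2],
      [forall z, forall z', (z != z') ==> [disjoint w z & w z']]
    & dinjectiveb fst (\bigcup_z w z)].

Definition joined h w :=
  [forall p : 'I_m * 'I_m, exists u in w (false, p.1),
    exists v in w (true, p.2), ~~ gap h u v].

Lemma card_scattered : #|[set w | scattered w]| <= ((2 * #|I|) ^ 4) ^ m.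
Proof.
pose small := [set A : {set V} | 0 < #|A| <= 2].
have sub_small : [set w | scattered w] \subset ffun_on small.
  apply/subsetP => w; rewrite inE => /and3P[/forallP small_w _ _].
  by apply/ffun_onP => z; rewrite inE.
apply: leq_trans (subset_leq_card sub_small) _; rewrite card_ffun_on.
rewrite card_prod card_bool card_ord -expnM -[4]/(2 * 2) -mulnA [leqRHS]expnM.
have [->|m_gt0] := posnP m; first by rewrite muln0.
rewrite leq_exp2r ?muln_gt0 //; apply: leq_trans (card_sets_of_size_1_or_2 _) _.
by rewrite card_prod card_bool mulnC.
Qed.

Lemma scattered_inj w z z' u v : scattered w ->
  u \in w z -> v \in w z' -> u.1 = v.1 -> z = z'.
Proof.
move=> /and3P[_ /forallP/(_ z)/forallP/(_ z') disj_w /dinjectiveP inj_w] wu wv uv.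
have euv : u = v by apply: inj_w uv; apply/bigcupP; [exists z | exists z'].
apply/eqP; apply: contraT => /(implyP disj_w)/disjointFr/(_ wu).
by rewrite euv wv.
Qed.

Section ScatteredFamily.
Variable w : {ffun bool * 'I_m -> {set V}}.
Hypothesis sc_w : scattered w.

Definition shadow z := [set u.1 | u in w z].

(* Members [w z] and [w z'] have no edge between them exactly when
   [h (i, j) = side i] and [h (j, i) = side j] for all [i] in [shadow z] and
   [j] in [shadow z']. *)
Definition side (i : I) := (i, true) \in \bigcup_z w z.

Lemma sideE z u : u \in w z -> side u.1 = u.2.
Proof.
have /and3P[_ _ /dinjectiveP inj_w] := sc_w => wu.
have cover_u : u \in \bigcup_z w z by apply/bigcupP; exists z.
case: u cover_u {wu} => i [] // cover_u; apply/negbTE/negP => cover_v.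
by have := inj_w _ _ cover_u cover_v erefl.
Qed.

Lemma card_shadow z : #|shadow z| <= 2.
Proof.
have /and3P[/forallP/(_ z)/andP[_ w_le2] _ _] := sc_w.
exact: leq_trans (leq_imset_card _ _) w_le2.
Qed.

Lemma shadow_inj z z' i : i \in shadow z -> i \in shadow z' -> z = z'.
Proof.
by move=> /imsetP[u wu ->] /imsetP[v wv]; apply: (scattered_inj sc_w).
Qed.

Definition cells (p : 'I_m * 'I_m) :=
  setX (shadow (false, p.1)) (shadow (true, p.2))
    :|: setX (shadow (true, p.2)) (shadow (false, p.1)).

Lemma card_cells p : #|cells p| <= 8.
Proof.
apply: leq_trans (leq_card_setU _ _) _; rewrite !cardsX.
by have := card_shadow (false, p.1); have := card_shadow (true, p.2); nia.
Qed.

Lemma disjoint_cells p p' : p != p' -> [disjoint cells p & cells p'].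
Proof.
move=> npp'; apply/pred0P => -[i j] /=; apply: contraNF npp'.
have eq_p x y : x \in shadow (false, p.1) -> x \in shadow (false, p'.1) ->
    y \in shadow (true, p.2) -> y \in shadow (true, p'.2) -> p == p'.
  move=> xp xp' yp yp'; have [ep1] := shadow_inj xp xp'.
  by have [ep2] := shadow_inj yp yp'; apply/eqP/injective_projections.
have shadowsF x z z' :
    x \in shadow (false, z) -> x \in shadow (true, z') -> False.
  by move=> xz /(shadow_inj xz).
rewrite !inE /= => /andP[/orP[]/andP[iz jz] /orP[]/andP[iz' jz']].
- exact: eq_p iz iz' jz jz'.
- by case: (shadowsF _ _ _ iz iz').
- by case: (shadowsF _ _ _ iz' iz).
- exact: eq_p jz jz' iz iz'.
Qed.

Lemma joined_deviates h p : joined h w -> deviates (fun d => side d.1) h (cells p).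
Proof.
move=> /forallP/(_ p)/exists_inP[u wu /exists_inP[v wv]].
have shadow_u : u.1 \in shadow (false, p.1) by apply: imset_f.
have shadow_v : v.1 \in shadow (true, p.2) by apply: imset_f.
have cell_uv : (u.1, v.1) \in cells p by rewrite in_setU !in_setX shadow_u shadow_v.
have cell_vu : (v.1, u.1) \in cells p.
  by rewrite in_setU !in_setX shadow_u shadow_v orbT.
rewrite /gap negb_and => /orP[] ne; apply/exists_inP.
  by exists (u.1, v.1); rewrite // (sideE wu) eq_sym.
by exists (v.1, u.1); rewrite // (sideE wv) eq_sym.
Qed.

Lemma card_joined :
  #|[set h | joined h w]| * 256 ^ (m * m)
    <= 255 ^ (m * m) * #|{ffun I * I -> bool}|.
Proof.
have cells_bits p : #|{: bool}| ^ #|cells p| <= 255.+1.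
  by rewrite card_bool -[255.+1]/(2 ^ 8) leq_exp2l // card_cells.
have := card_forall_deviates (fun d => side d.1) cells_bits disjoint_cells.
rewrite card_prod card_ord; apply: leq_trans.
rewrite leq_mul2r subset_leq_card ?orbT //; apply/subsetP => h.
by rewrite !inE => joined_h; apply/forallP => p; apply: joined_deviates.
Qed.

End ScatteredFamily.

Lemma exists_unjoined : 0 < m -> (2 * #|I|) ^ 4 * 255 ^ m < 256 ^ m ->
  exists h, forall w, scattered w -> ~~ joined h w.
Proof.
move=> m_gt0 lt_pow.
have [|||h unjoined] := @union_bound _ _ [set w | scattered w]
    (fun w => [set h | joined h w]) (256 ^ (m * m)) (255 ^ (m * m)).
- by move=> w; rewrite inE; apply: card_joined.
- by rewrite card_ffun expn_gt0 card_bool.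
- apply: leq_ltn_trans (leq_mul card_scattered (leqnn _)) _.
  by rewrite !(expnM _ m m) -expnMn ltn_exp2r.
by exists h => w sc_w; have := unjoined w; rewrite !inE; apply.
Qed.

Lemma joined_plant (s : {perm I}) h w :
  {in \bigcup_z w z, forall u, s u.1 = u.1} -> scattered w ->
  joined (plant s h) w -> joined h w.
Proof.
move=> fixed_w sc_w /forallP joined_w; apply/forallP => p.
have /exists_inP[u wu /exists_inP[v wv ngap]] := joined_w p.
apply/exists_inP; exists u => //; apply/exists_inP; exists v => //.
rewrite gap_plant_fixed // in ngap.
- by apply/eqP => /(scattered_inj sc_w wu wv).
- by apply: fixed_w; apply/bigcupP; exists (false, p.1).
- by apply: fixed_w; apply/bigcupP; exists (true, p.2).
Qed.

Lemma minor_scattered_joined h (F : {set I}) t :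
    has_complete_minor (gap_graph h) t ->
    2 * #|I| + 4 * #|F| + 16 * m <= 3 * t ->
  exists w,
    [/\ scattered w, {in \bigcup_z w z, forall u, u.1 \notin F} & joined h w].
Proof.
move=> [B [connB disjB adjB]] le_t; pose Q := [set i | #|B i| <= 2].
have nzB i : B i != set0 by case: (connB i).
have cardQ : 3 * t <= 2 * #|I| + 2 * #|Q|.
  have := card_small_members disjB 2 nzB.
  by rewrite card_ord card_prod card_bool [#|I| * 2]mulnC.
have card_pair i : #|[set u : V | u.1 \in [set i]]| <= 2.
  have -> : [set u : V | u.1 \in [set i]] = setX [set i] [set: bool].
    by apply/setP => u; rewrite !inE andbT.
  by rewrite cardsX cards1 cardsT card_bool.
have [|i|S [/subsetP SQ avoidS injS leQ]] :=
  exists_injective_subfamily disjB F (Q := Q) (s := 2) card_pair.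
- by move=> i; rewrite inE; apply: connected_card2_injective.
- by rewrite inE card_gt0 nzB.
have [|e e_inj eS] := @exists_injection_into _ (bool * 'I_m)%type S.
  by rewrite card_prod card_bool card_ord; lia.
pose w : {ffun bool * 'I_m -> {set V}} := [ffun z => B (e z)].
have sub_S u : u \in \bigcup_z w z -> u \in \bigcup_(i in S) B i.
  by move=> /bigcupP[z _]; rewrite ffunE => Bu; apply/bigcupP; exists (e z).
exists w; split=> [|u /sub_S/avoidS //|].
- apply/and3P; split.
  + apply/forallP => z; rewrite ffunE card_gt0 nzB.
    by have := SQ _ (eS z); rewrite inE.
  + apply/forallP => z; apply/forallP => z'; apply/implyP => nzz'.
    by rewrite !ffunE disjB // (inj_eq e_inj).
  + by apply/dinjectiveP => u v /sub_S Su /sub_S Sv; apply: injS.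
- apply/forallP => p; rewrite !ffunE.
  have [|u [v [Bu Bv /andP[_ ngap]]]] := adjB (e (false, p.1)) (e (true, p.2)).
    by rewrite (inj_eq e_inj).
  by apply/exists_inP; exists u => //; apply/exists_inP; exists v.
Qed.

End ScatteredFamilies.

Lemma exists_planted_without_minor n m t (s : {perm 'I_n}) :
    0 < m -> (2 * n) ^ 4 * 255 ^ m < 256 ^ m ->
    2 * n + 4 * #|moved_points s| + 16 * m <= 3 * t ->
  exists h, ~ has_complete_minor (gap_graph (plant s h)) t.
Proof.
move=> m_gt0 lt_pow le_t; rewrite -{1}(card_ord n) in lt_pow.
have [h unjoined] := exists_unjoined m_gt0 lt_pow.
exists h => minor_t; rewrite -{1}(card_ord n) in le_t.
have [w [sc_w fixed_w joined_w]] := minor_scattered_joined minor_t le_t.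
have /negP[] := unjoined w sc_w.
apply: (joined_plant _ sc_w joined_w) => u /fixed_w.
by rewrite inE negbK => /eqP.
Qed.

Lemma bernoulli_nat q j : (q + j) * q ^ j <= q * q.+1 ^ j.
Proof.
elim: j => [|j IHj]; first by rewrite addn0.
by rewrite !expnS; move: (q ^ j) (q.+1 ^ j) IHj => x y; nia.
Qed.

(* Bernoulli's inequality makes [(q.+1 / q) ^ m] at least linear in [m]; applying
   it to [m %/ d.+1] and raising to the power [d.+1] gives degree [d.+1]. *)
Lemma polynomial_lt_exponential C d q : 0 < q ->
  exists M, forall m, M <= m -> C * m ^ d * q ^ m < q.+1 ^ m.
Proof.
move=> q_gt0; pose K := C * d.+1 ^ d * q ^ d.+1.
exists (d.+1 * K.+1) => m leKm; pose j := m %/ d.+1.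
have ltKj : K < q + j by rewrite ltn_addl // leq_divRL // mulnC.
have le_m : m <= d.+1 * (q + j).
  by have := ltn_ceil m (ltn0Sn d); rewrite -/j; nia.
have growth : (q + j) ^ d.+1 * q ^ m <= q ^ d.+1 * q.+1 ^ m.
  have -> : m = j * d.+1 + m %% d.+1 := divn_eq m d.+1.
  rewrite !expnD !(expnM _ j) !mulnA -!expnMn leq_mul //.
    by rewrite leq_exp2r // bernoulli_nat.
  by case: (m %% d.+1) => // r; rewrite leq_exp2r.
rewrite -(@ltn_pmul2l (q ^ d.+1)) ?expn_gt0 ?q_gt0 //.
apply: leq_trans growth; rewrite mulnA ltn_pmul2r ?expn_gt0 ?q_gt0 //.
apply: (@leq_ltn_trans (K * (q + j) ^ d)).
  rewrite mulnC /K [leqRHS]mulnAC leq_mul2r -mulnA -expnMn leq_mul2l.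
  by have [->|d_gt0] := posnP d; [rewrite !orbT | rewrite leq_exp2r // le_m !orbT].
by rewrite expnS ltn_pmul2r // expn_gt0; lia.
Qed.

(* [2 * t + 2 * n * L <= 3 * t * L] reads [n <= (3 / 2 - 1 / L) * t]. *)
Lemma exists_minor_free_not_kempe_equivalent L : 0 < L ->
  exists t0, forall t n, t0 <= t -> 2 < n -> 2 * t + 2 * n * L <= 3 * t * L ->
    exists G : sgraph,
      ~ has_complete_minor G t /\ ~ all_colourings_kempe_equivalent G n.
Proof.
move=> L_gt0.
have [M leM] := polynomial_lt_exponential ((96 * L) ^ 4) 4 (isT : 0 < 255).
exists (16 * L * M.+1) => t n le_t n_gt2 le_n.
have [|s [free_s [i nsi] card_moved]] := @exists_three_cycle 'I_n.
  by rewrite card_ord.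
pose m := t %/ (16 * L).
have le_mt : m * (16 * L) <= t by apply: leq_divM.
have lt_tm : t < m.+1 * (16 * L) by rewrite ltn_ceil // muln_gt0.
have lt_Mm : M < m by rewrite leq_divRL ?muln_gt0 // mulnC.
have le_nt : 2 * n <= 3 * t by rewrite -(leq_pmul2r L_gt0); nia.
have le_nm : 2 * n <= 96 * L * m by nia.
have [|||h no_minor] := @exists_planted_without_minor n m t s.
- exact: leq_ltn_trans lt_Mm.
- apply: leq_ltn_trans (leM m (ltnW lt_Mm)).
  by rewrite leq_mul2r -expnMn leq_exp2r // le_nm orbT.
- by rewrite -(leq_pmul2r L_gt0); nia.
exists (gap_graph (plant s h)); split=> //.
exact: planted_not_all_kempe_equivalent nsi.
Qed.

Import Order.TTheory GRing.Theory Num.Theory.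
Local Open Scope ring_scope.

Lemma exists_natr_mul_ge (R : archiRealFieldType) (x y : R) : 0 < x ->
  exists2 N : nat, (0 < N)%N & y <= N%:R * x.
Proof.
move=> x_gt0; exists (Num.truncn (y / x)).+1 => //.
by rewrite -ler_pdivrMr //; apply/ltW/truncnS_gt.
Qed.

Theorem theorem1 (R : realType) (eps : R) (eps_gt0 : 0 < eps)
    (eps_lt : eps < 3 / 2) :
  exists t0 : nat, forall t : nat, (t0 <= t)%N ->
    exists G : sgraph,
      ~ has_complete_minor G t /\
      ~ all_colourings_kempe_equivalent G (Num.truncn ((3 / 2 - eps) * t%:R)).
Proof.
have slope_gt0 : 0 < 3 / 2 - eps by rewrite subr_gt0.
have [L L_gt0 L_eps] := exists_natr_mul_ge 1 eps_gt0.
have [N _ N_slope] := exists_natr_mul_ge 3 slope_gt0.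
have [t0 graph_t0] := exists_minor_free_not_kempe_equivalent L_gt0.
exists (maxn t0 N) => t; rewrite geq_max => /andP[le_t0t le_Nt].
set n := Num.truncn _; apply: graph_t0 => //.
  by rewrite truncn_gt_nat (le_trans N_slope) // mulrC ler_wpM2l ?ler_nat // ltW.
have le_n : n%:R <= (3 / 2 - eps) * t%:R by rewrite truncn_le mulr_ge0 // ltW.
have le_nL := ler_wpM2r (ler0n R L) le_n.
have le_tL := ler_wpM2r (ler0n R t) L_eps.
by rewrite -(ler_nat R) !natrD !natrM; lra.
Qed.
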